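(* Let $a\le x<x'\le b$ be real numbers, $0<\alpha\le\frac12$, $y=(1-\alpha)x+\alpha x'$, $y'=\alpha x+(1-\alpha)x'$. Let $f:[a,b]\to\mathbb{R}$ be convex and let $p:[x,x']\to[0,\infty)$ be integrable and symmetric about $\frac{x+x'}{2}$. Let $\mathrm{Mp}:[0,1]\to\mathbb{R}$ be the function defined in the context. Then $\mathrm{Mp}$ is convex and increasing on $[0,1]$, and for all $t\in[0,1]$ $$\int_x^{x'}\left[f((1-\alpha)x+\alpha s)+f((1-\alpha)x'+\alpha s)\right]p(s)\,ds=\mathrm{Mp}(0)\le \mathrm{Mp}(t)\le \mathrm{Mp}(1)=\frac{f(x)+f(y)+f(y')+f(x')}{2}\int_x^{x'}p(s)\,ds$$ and $$\begin{aligned}\mathrm{Mp}(t)&\le(1-t)\int_x^{x'}\left[f((1-\alpha)x+\alpha s)+f((1-\alpha)x'+\alpha s)\right]p(s)\,ds+t\left[\frac{f(x)+f(y)+f(y')+f(x')}{2}\right]\int_x^{x'}p(s)\,ds\\&\le\frac{f(x)+f(y)+f(y')+f(x')}{2}\int_x^{x'}p(s)\,ds\\&\le[f(x)+f(x')]\int_x^{x'}p(s)\,ds.\end{aligned}$$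
   Context: Symmetric about $\frac{x+x'}{2}$ means $p(s)=p(x+x'-s)$ for $s\in[x,x']$. ''Increasing'' is meant in the weak (non-strict) sense. For $t\in[0,1]$ define $$\begin{aligned}\mathrm{Mp}(t)=&\int_x^{\frac{x+x'}{2}}\left[f\big(tx+(1-t)((1-\alpha)x+\alpha s)\big)+f\big(ty'+(1-t)((1-\alpha)x'+\alpha s)\big)\right]p(s)\,ds\\&+\int_{\frac{x+x'}{2}}^{x'}\left[f\big(ty+(1-t)((1-\alpha)x+\alpha s)\big)+f\big(tx'+(1-t)((1-\alpha)x'+\alpha s)\big)\right]p(s)\,ds.\end{aligned}$$ *)

(* Defs.v *)
From HB Require Import structures.
From mathcomp Require Import all_boot all_order all_algebra.
From mathcomp Require Import all_classical all_reals all_analysis.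
Set Implicit Arguments.
Unset Strict Implicit.
Unset Printing Implicit Defensive.
Import Order.TTheory GRing.Theory Num.Theory.
Import numFieldNormedType.Exports.
Local Open Scope classical_set_scope.
Local Open Scope ring_scope.

(* "Integrable" is read in the sense of Lebesgue.  The completed Lebesgue
   measure is used, instead of its restriction [lebesgue_measure] to the Borel
   sets, so that weights that are not Borel measurable are covered as well. *)
Notation Leb R := (@completed_lebesgue_measure R).

(* Real functions on a segment are rendered by total functions [R -> R] whose
   values outside of the segment are irrelevant. *)
Definition symmetric_about_midpoint (R : realType) (x x' : R) (p : R -> R) :=
  {in `[x, x'], forall s, p s = p (x + x' - s)}.

(* [Rintegral] is total; when [f] is convex on a segment containing [x, x'], [p]
   is integrable on [x, x'] and [0 <= t <= 1], both integrands below are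
   integrable, since [f] is then bounded and Borel measurable. *)
Definition Mp (R : realType) (f p : R -> R) (alpha x x' t : R) : R :=
  let y := (1 - alpha) * x + alpha * x' in
  let y' := alpha * x + (1 - alpha) * x' in
  let m := (x + x') / 2 in
  \int[Leb R]_(s in `[x, m])
    ((f (t * x + (1 - t) * ((1 - alpha) * x + alpha * s))
      + f (t * y' + (1 - t) * ((1 - alpha) * x' + alpha * s))) * p s)
  + \int[Leb R]_(s in `[m, x'])
    ((f (t * y + (1 - t) * ((1 - alpha) * x + alpha * s))
      + f (t * x' + (1 - t) * ((1 - alpha) * x' + alpha * s))) * p s).

(* Main.v *)
(* The substitution s -> x + x' - s turns the second integral of Mp(t) into one
   over [x, m], with m = (x + x') / 2 and the same weight p.  With
   d = (1 - t) * alpha * (s - x), this gives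
     Mp(t) = int_x^m (f(x + d) + f(y - d) + f(y' + d) + f(x' - d)) p(s) ds.
   For fixed s the integrand is convex in t, since d is affine in t.  As t grows,
   the points x + d and y - d spread apart with fixed midpoint, and so do y' + d
   and x' - d, hence the integrand increases by convexity of f.  Everything else
   follows from Mp(0), Mp(1) and the convexity of Mp. *)
Require Import Defs.
From HB Require Import structures.
From mathcomp Require Import all_boot all_order all_algebra.
From mathcomp Require Import all_classical all_reals all_analysis.
From mathcomp Require Import measurable_realfun lra ring.
Import Order.TTheory GRing.Theory Num.Theory.
Import numFieldNormedType.Exports.
Local Open Scope classical_set_scope.
Local Open Scope ring_scope.
Set Implicit Arguments.
Unset Strict Implicit.

(** * Convexity on a segment *)

(** The weight is a plain real and membership is a pair of inequalities, so that linear arithmetic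
    applies directly. *)
Definition convex_on (R : realType) (u v : R) (g : R -> R) :=
  forall k s t, 0 <= k <= 1 -> u <= s <= v -> u <= t <= v ->
    g (k * s + (1 - k) * t) <= k * g s + (1 - k) * g t.

Lemma convex_functionP (R : realType) (u v : R) (g : R -> R) :
  convex_function (E := R^o) `[u, v] g <-> convex_on u v g.
Proof.
split=> [cg k s t k01 us ut|cg k s t].
  have [k0 k1] := andP k01.
  by have := cg (Itv01 k0 k1) s t; apply; rewrite inE /= in_itv.
rewrite !inE /= !in_itv/= => us ut.
by apply: cg => //; apply/andP; split; [exact: ge0|exact: le1].
Qed.

Lemma convex_on_affine (R : realType) (a b u v A B : R) (f : R -> R) :
  convex_on a b f ->
  (forall s, u <= s <= v -> a <= A + B * s <= b) ->
  convex_on u v (fun s => f (A + B * s)).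
Proof.
move=> cf H k s t k01 us vt.
suff -> : A + B * (k * s + (1 - k) * t) =
  k * (A + B * s) + (1 - k) * (A + B * t) by apply: cf => //; exact: H.
ring.
Qed.

Lemma barycentric (R : realType) (u v w : R) : u <= w <= v ->
  exists2 k, 0 <= k <= 1 & w = k * u + (1 - k) * v.
Proof.
move=> /andP[uw wv].
have [uv|uv] := eqVneq u v; first by exists 0; lra.
have ltuv : 0 < v - u by rewrite subr_gt0 lt_neqAle uv (le_trans uw).
exists ((v - w) / (v - u)); first by rewrite divr_ge0 ?ler_pdivrMr/=; lra.
by field; rewrite gt_eqF.
Qed.

(** If [w] has weights [k] and [1 - k], its mirror image [u + v - w] has them swapped; the two
    convexity inequalities add up. *)
Lemma convex_on_symmetric_le (R : realType) (u v w : R) (f : R -> R) :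
  convex_on u v f -> u <= w <= v -> f w + f (u + v - w) <= f u + f v.
Proof.
move=> cf uwv; have [k k01 wE] := barycentric uwv.
have uv : u <= v by lra.
have := cf k u v k01; have := cf k v u k01; rewrite !lexx uv -wE.
have -> : k * v + (1 - k) * u = u + v - w by lra.
by move=> /(_ isT isT) ? /(_ isT isT) ?; lra.
Qed.

Lemma convex_onW (R : realType) (a b u v : R) (f : R -> R) :
  a <= u -> v <= b -> convex_on a b f -> convex_on u v f.
Proof. by move=> au vb cf k s t ? ? ?; apply: cf => //; lra. Qed.

(** * Integrability of a convex function against the weight *)

Lemma convex_on_measurable (R : realType) (u v : R) (g : R -> R) :
  convex_on u v g -> measurable_fun (`[u, v]%classic : set R) g.
Proof.
(* The strict sublevel sets of a convex function are intervals. *)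
move=> cg; apply: (measurability _ (RGenInftyO.measurableE R)).
move=> _ [_ [r ->] <-]; apply: is_interval_measurable => s t /=.
rewrite !in_itv/= => -[us gs] [ut gt] z szt; rewrite !in_itv/=.
split; first by lra.
have [k k01 ->] := barycentric szt.
apply: le_lt_trans (cg k s t k01 us ut) _.
(* The bound must be strict: for [k = 0] it comes from [gt], otherwise from [gs] scaled by
   [k > 0]. *)
have [k0|k0] := eqVneq k 0; first by rewrite k0; lra.
have : 0 < k by rewrite lt_neqAle eq_sym k0; case/andP: k01.
nra.
Qed.

Lemma convex_on_bounded (R : realType) (u v : R) (g : R -> R) :
  convex_on u v g -> exists M, forall s, u <= s <= v -> `|g s| <= M.
Proof.
move=> cg; pose B := `|g u| + `|g v|.
have gB s : u <= s <= v -> g s <= B.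
  move=> usv; have [k k01 ->] := barycentric usv.
  have uv : u <= v by lra.
  have := cg k u v k01; rewrite !lexx uv => /(_ isT isT) /le_trans; apply.
  have := ler_norm (g u); have := ler_norm (g v).
  have := normr_ge0 (g u); have := normr_ge0 (g v); rewrite /B; nra.
(* For the lower bound, convexity at the midpoint of s and its mirror image
   u + v - s gives 2 * g ((u + v) / 2) <= g s + B. *)
exists (B + 2 * `|g ((u + v) / 2)|) => s usv.
have usv' : u <= u + v - s <= v by lra.
have h : 0 <= (1 / 2 : R) <= 1 by lra.
have := cg _ _ _ h usv usv'.
have -> : 1 / 2 * s + (1 - 1 / 2) * (u + v - s) = (u + v) / 2 by field.
have := gB _ usv; have := gB _ usv'; set m := g (_ / 2).
have := normr_ge0 m; have := ler_norm (- m); rewrite normrN.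
move=> *; rewrite ler_norml; lra.
Qed.

(* The carrier of [Leb R]: the reals with the Caratheodory-measurable sets. *)
Notation LR R := (caratheodory_type (wlength (@idfun R))^*%mu).

Lemma Leb_measurable_itv (R : realType) (j : interval R) :
  measurable ([set` j] : set (LR R)).
Proof. by apply: sub_caratheodory; exact: measurable_itv. Qed.

(** A bounded measurable function times an integrable one is integrable; Borel measurability carries
    over to the larger sigma-algebra. *)
Lemma convex_on_integrable (R : realType) (u v : R) (g p : R -> R) :
  convex_on u v g -> (Leb R).-integrable `[u, v] (EFin \o p) ->
  (Leb R).-integrable `[u, v] (EFin \o (fun s => g s * p s)).
Proof.
move=> cg ip.
have mI := Leb_measurable_itv `[u, v].
apply: (@integrableMr _ (LR R) R (Leb R) _ mI g (EFin \o p)) => //.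
  move=> _ B mB; apply: sub_caratheodory.
  exact: convex_on_measurable cg _ _ mB.
have [M gM] := convex_on_bounded cg.
exists M; split; first exact: num_real.
move=> z Mz s; rewrite /= in_itv/= => /gM /le_trans; apply; exact: ltW.
Qed.

(** * Invariance of the Lebesgue integral under reflections *)

Lemma preimage_reflection_itv (R : realType) (c u v : R) (b0 b1 : bool) :
  (fun s => c - s) @^-1` [set` Interval (BSide b0 u) (BSide b1 v)] =
  [set` Interval (BSide (~~ b1) (c - v)) (BSide (~~ b0) (c - u))].
Proof.
by apply/seteqP; case: b0 b1 => -[]; split=> s /=; rewrite !in_itv/=; lra.
Qed.

(** The image measure agrees with Lebesgue measure on half-open intervals, which determine it.
    Reflection moves the open end to the other side but keeps the length. *)
Lemma lebesgue_reflection (R : realType) (c : R) (A : set (measurableTypeR R)) :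
  measurable A ->
  measurable ((fun s => c - s) @^-1` A : set (measurableTypeR R)) /\
  lebesgue_measure ((fun s => c - s) @^-1` A) = lebesgue_measure A.
Proof.
have mphi : measurable_fun [set: measurableTypeR R]
    ((fun s => c - s) : _ -> measurableTypeR R).
  by apply: measurable_funB.
move=> mA; split; first by rewrite -[X in measurable X]setTI; exact: mphi.
rewrite -[LHS]/(pushforward lebesgue_measure
  ((fun s => c - s) : _ -> measurableTypeR R) A).
apply/esym/lebesgue_measure_unique => //.
move=> _ [[a b]] _ <-.
rewrite [RHS](_ : _ = lebesgue_measure (`[c - b, c - a[%classic : set R)).
  rewrite !lebesgue_measure_itv/= !lte_fin ltrD2l ltrN2.
  by case: ifP => // _; congr EFin; ring.
congr (lebesgue_measure _); exact: preimage_reflection_itv.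
Qed.

(** Used twice to pass to the completed measure: for a Borel set with a null part, and for its
    reflection. *)
Lemma Leb_setU0 (R : realType) (X N : set R) :
  measurable (X : set (measurableTypeR R)) ->
  (@lebesgue_measure R).-negligible N ->
  measurable (X `|` N : set (LR R)) /\ Leb R (X `|` N) = lebesgue_measure X.
Proof.
move=> mX [B [mB B0 NB]].
have mX' : measurable (X : set (LR R)) by exact: sub_caratheodory.
have nN : (Leb R).-negligible N.
  by exists B; split=> //; exact: sub_caratheodory.
have mN : measurable (N : set (LR R)) by exact: negligible_sub_caratheodory.
split; first exact: measurableU.
rewrite measureU0//.
by apply/(@negligibleP _ _ _ (Leb R)).
Qed.

Lemma completed_lebesgue_reflection (R : realType) (c : R) (A : set (LR R)) :
  measurable A ->
  measurable ((fun s => c - s) @^-1` A : set (LR R)) /\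
  Leb R ((fun s => c - s) @^-1` A) = Leb R A.
Proof.
(* A set measurable for [Leb R] is a Borel set up to a negligible set. *)
move=> mA; have : completed_algebra_gen (@lebesgue_measure R) A.
  by rewrite -g_sigma_completed_algebra_genE completed_caratheodory_measurable.
move=> {mA} [X mX [N nN <-]].
have [mX' X'E] := lebesgue_reflection c mX.
have nN' : (@lebesgue_measure R).-negligible ((fun s => c - s) @^-1` N).
  have [B [mB B0 NB]] := nN; have [mB' B'E] := lebesgue_reflection c mB.
  exists ((fun s => c - s) @^-1` B); split=> //; first by rewrite B'E.
  by move=> s; exact: NB.
have [mXN XNE] := Leb_setU0 mX nN.
have [mXN' XN'E] := Leb_setU0 mX' nN'; split; first exact: mXN'.
exact: etrans XN'E (etrans X'E (esym XNE)).
Qed.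

(** [Leb R] is its own image under [phi], so this is the change of variables formula for image
    measures. *)
Lemma Rintegral_reflection (R : realType) (c u v : R) (g : R -> R) :
  (Leb R).-integrable `[u, v] (EFin \o g) ->
  (Leb R).-integrable `[c - v, c - u] (EFin \o (fun s => g (c - s))) /\
  \int[Leb R]_(s in `[u, v]) g s =
  \int[Leb R]_(s in `[c - v, c - u]) g (c - s).
Proof.
pose phi : LR R -> LR R := fun s => c - s.
have mphi : measurable_fun [set: LR R] phi.
  move=> _ B mB; rewrite setTI.
  by case: (completed_lebesgue_reflection c mB).
have mphiA A : measurable A -> measurable (phi @^-1` A).
  by move=> mA; case: (completed_lebesgue_reflection c mA).
have phiE A : measurable A -> pushforward (Leb R) phi A = Leb R A.
  by move=> mA; case: (completed_lebesgue_reflection c mA).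
pose D : set (LR R) := `[u, v]%classic.
have mD : measurable D := Leb_measurable_itv `[u, v].
have DE : `[c - v, c - u]%classic = phi @^-1` D.
  exact/esym/preimage_reflection_itv.
rewrite DE => ig.
(* Extending [g] by zero outside [D] gives the measurability on the whole line that this formula
   requires. *)
pose G : LR R -> \bar R := (EFin \o g) \_ D.
have mG : measurable_fun [set: LR R] G.
  by apply/(measurable_restrictT _ mD); exact: measurable_int ig.
have GE s : D s -> G s = (g s)%:E by move=> Ds; rewrite /G /patch mem_set.
have iG : (Leb R).-integrable D G.
  by apply: eq_integrable ig => // s; rewrite inE => /GE.
have iGphi : (Leb R).-integrable (phi @^-1` D) (G \o phi).
  apply/integrableP; split.
    exact: measurable_funTS (measurableT_comp mG mphi).
  have -> : (\int[Leb R]_(s in phi @^-1` D) `|(G \o phi) s| =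
      \int[Leb R]_(s in D) `|G s|)%E.
    transitivity (\int[pushforward (Leb R) phi]_(s in D) `|G s|)%E.
      rewrite (ge0_integral_pushforward mphi)//.
      exact/measurable_funTS/measurableT_comp.
    by apply: eq_measure_integral => A mA _; exact: phiE.
  by have /integrableP[] := iG.
split.
  by apply: eq_integrable iGphi => [|s]; [exact: mphiA|rewrite inE => /GE /= ->].
congr fine.
transitivity (\int[Leb R]_(s in D) G s)%E.
  by apply: eq_integral => s; rewrite inE => /GE.
transitivity (\int[pushforward (Leb R) phi]_(s in D) G s)%E.
  by apply: eq_measure_integral => A mA _; exact/esym/phiE.
rewrite (integral_pushforward mphi mG iGphi mD).
by apply: eq_integral => s; rewrite inE => /GE.
Qed.

(** The two closed halves overlap only in the null set [[set m]]. *)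
Lemma Rintegral_itv_split (R : realType) (u m v : R) (g : R -> R) :
  u <= m <= v ->
  (Leb R).-integrable `[u, v] (EFin \o g) ->
  \int[Leb R]_(s in `[u, v]) g s =
  \int[Leb R]_(s in `[u, m]) g s + \int[Leb R]_(s in `[m, v]) g s.
Proof.
move=> /andP[um mv] ig.
have mI := @Leb_measurable_itv R.
have m1 : measurable ([set m] : set (LR R)).
  by apply: sub_caratheodory; exact: measurable_set1.
have iS (j : interval R) : [set` j] `<=` `[u, v]%classic ->
    (Leb R).-integrable [set` j] (EFin \o g).
  by move=> iuv; exact: integrableS ig.
have iU : `[u, v]%classic = `[u, m] `|` `]m, v].
  by rewrite -itv_bndbnd_setU// bnd_simp.
have mvE : `[m, v]%classic = [set m] `|` `]m, v].
  by rewrite setU1itv// bnd_simp.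
have im : (Leb R).-integrable [set m] (EFin \o g).
  apply: (integrableS _ _ _ ig) => //.
  by move=> _ -> /=; rewrite in_itv/= um.
have m0 : \int[Leb R]_(s in [set m]) g s = 0.
  rewrite /Rintegral null_set_integral//.
  + exact: measurable_int im.
  + exact: lebesgue_measure_set1.
rewrite iU mvE !Rintegral_setU// ?m0 ?add0r//.
- by rewrite -mvE; apply: iS; apply: subset_itvr; rewrite bnd_simp.
- by apply/disj_setPS => s [/= ->]; rewrite in_itv/= ltxx.
- by rewrite -iU.
- apply/disj_setPS => s [/=]; rewrite !in_itv/=; lra.
Qed.

(** * Convexity facts for the integrands *)

Lemma convex_on_add (R : realType) (u v : R) (g h : R -> R) :
  convex_on u v g -> convex_on u v h -> convex_on u v (fun s => g s + h s).
Proof.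
move=> cg ch k s t k01 us ut.
by have := cg k s t k01 us ut; have := ch k s t k01 us ut; lra.
Qed.

Lemma convex_comb_itv (R : realType) (u v k s t : R) :
  0 <= k <= 1 -> u <= s <= v -> u <= t <= v -> u <= k * s + (1 - k) * t <= v.
Proof. by nra. Qed.

(** Covers every argument of [f] in [Mp]: it is affine in [s], and as an iterated convex combination
    it stays in the segment. *)
Lemma convex_on_contraction (R : realType) (x x' alpha t c e : R) (f : R -> R) :
  convex_on x x' f -> 0 <= alpha <= 1 -> 0 <= t <= 1 ->
  x <= c <= x' -> x <= e <= x' ->
  convex_on x x' (fun s => f (t * c + (1 - t) * ((1 - alpha) * e + alpha * s))).
Proof.
move=> cf a01 t01 xc xe.
have := @convex_on_affine _ x x' x x' (t * c + (1 - t) * ((1 - alpha) * e))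
  ((1 - t) * alpha) f cf.
have E s : t * c + (1 - t) * ((1 - alpha) * e) + (1 - t) * alpha * s =
  t * c + (1 - t) * ((1 - alpha) * e + alpha * s) by ring.
under eq_fun do rewrite E; apply=> s xs; rewrite E.
apply: convex_comb_itv => //.
have a01' : 0 <= 1 - alpha <= 1 by lra.
by have := convex_comb_itv a01' xe xs; rewrite subKr.
Qed.

(** On the smaller segment from [u + d] to [v - d], the points [u + e] and [v - e] are mirror
    images; [d + e <= v - u] places them inside it. *)
Lemma convex_on_spread_le (R : realType) (u v d e : R) (f : R -> R) :
  convex_on u v f -> 0 <= d <= e -> d + e <= v - u ->
  f (u + e) + f (v - e) <= f (u + d) + f (v - d).
Proof.
move=> cf de deuv.
have cf' : convex_on (u + d) (v - d) f by apply: convex_onW cf; lra.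
have ude : u + d <= u + e <= v - d by lra.
have := convex_on_symmetric_le cf' ude.
by have -> : u + d + (v - d) - (u + e) = v - e by ring.
Qed.

(* The integrand of [Mp] relative to [p] on the left half of the segment, after
   the substitution s -> x + x' - s in the second integral. *)
Definition folded (R : realType) (f : R -> R) (alpha x x' t s : R) : R :=
  let y := (1 - alpha) * x + alpha * x' in
  let y' := alpha * x + (1 - alpha) * x' in
  let d := (1 - t) * (alpha * (s - x)) in
  f (x + d) + f (y - d) + (f (y' + d) + f (x' - d)).

(** * Monotonicity and convexity in [t] of the folded integrand *)

Section folded_theory.
Context (R : realType) (x x' alpha : R) (f : R -> R).
Hypotheses (xx' : x <= x') (alpha01 : 0 <= alpha <= 1) (cf : convex_on x x' f).

Let m := (x + x') / 2.
Let y := (1 - alpha) * x + alpha * x'.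
Let y' := alpha * x + (1 - alpha) * x'.

Let xy : x <= y <= x'.
Proof.
have a01 : 0 <= 1 - alpha <= 1 by move: alpha01; lra.
rewrite /y -[X in X * x'](subKr 1 alpha).
by apply: convex_comb_itv; rewrite ?lexx ?xx'.
Qed.

Let xy' : x <= y' <= x'.
Proof. by apply: convex_comb_itv; rewrite ?lexx ?xx'. Qed.

Let dE : y - x = alpha * (x' - x) /\ x' - y' = alpha * (x' - x).
Proof. by rewrite /y /y'; split; ring. Qed.

(** As [s - x] is at most half of [x' - x], the displacement is at most half the common length of
    the segments from [x] to [y] and from [y'] to [x']: the moving points do not cross. *)
Let dist_bounds t s : 0 <= t <= 1 -> x <= s <= m ->
  0 <= (1 - t) * (alpha * (s - x)) <= alpha * (x' - x) / 2.
Proof.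
move=> t01; rewrite -mulrA; have /andP[a0 _] := alpha01; rewrite /m => xsm.
have /andP[D0 D1] : 0 <= alpha * (s - x) <= alpha * ((x' - x) / 2).
  by rewrite mulr_ge0 ?ler_wpM2l//; lra.
rewrite mulr_ge0//=; last by lra.
by rewrite (le_trans _ D1)// ler_piMl//; lra.
Qed.

Lemma folded_nondecreasing s t1 t2 : x <= s <= m -> 0 <= t1 -> t1 <= t2 ->
  t2 <= 1 -> folded f alpha x x' t1 s <= folded f alpha x x' t2 s.
Proof.
move=> xsm t10 t12 t21; rewrite /folded -/y -/y'.
have := xy; have := xy'; have [E1 E2] := dE => yP y'P.
have t1P : 0 <= t1 <= 1 by lra.
have t2P : 0 <= t2 <= 1 by lra.
have := dist_bounds t1P xsm; have := dist_bounds t2P xsm.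
have : (1 - t2) * (alpha * (s - x)) <= (1 - t1) * (alpha * (s - x)).
  have /andP[a0 _] := alpha01.
  by rewrite ler_wpM2r ?mulr_ge0//; lra.
move: (_ * _) (_ * _) => d2 d1 d21 d2P d1P.
apply: lerD; apply: convex_on_spread_le; try lra.
  by apply: convex_onW cf; lra.
by apply: convex_onW cf; lra.
Qed.

(** Each of the four arguments of [f] is affine in [t] and stays in the segment; [cp] and [cm] treat
    the two signs of the displacement. *)
Lemma folded_convex s : x <= s <= m ->
  convex_on 0 1 (fun t => folded f alpha x x' t s).
Proof.
move=> xsm; rewrite /folded -/y -/y'.
have := xy; have := xy'; have [E1 E2] := dE => yP y'P.
pose D := alpha * (s - x).
have cp c : (forall t, 0 <= t <= 1 -> x <= c + (1 - t) * D <= x') ->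
    convex_on 0 1 (fun t => f (c + (1 - t) * D)).
  move=> H; have E t : c + (1 - t) * D = c + D + - D * t by ring.
  under eq_fun do rewrite E; apply: convex_on_affine cf _ => t t01.
  by rewrite -E; exact: H.
have cm c : (forall t, 0 <= t <= 1 -> x <= c - (1 - t) * D <= x') ->
    convex_on 0 1 (fun t => f (c - (1 - t) * D)).
  move=> H; have E t : c - (1 - t) * D = c - D + D * t by ring.
  under eq_fun do rewrite E; apply: convex_on_affine cf _ => t t01.
  by rewrite -E; exact: H.
apply: convex_on_add; apply: convex_on_add; first [apply: cp | apply: cm];
  by move=> t /dist_bounds /(_ xsm); rewrite -/D; lra.
Qed.

(** * [Mp] as an integral over the left half *)

Variable p : R -> R.
Hypotheses (ip : (Leb R).-integrable `[x, x'] (EFin \o p))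
  (sp : symmetric_about_midpoint x x' p).

Let integrable_half (g : R -> R) (j : interval R) :
  [set` j] `<=` `[x, x']%classic -> convex_on x x' g ->
  (Leb R).-integrable [set` j] (EFin \o (fun s => g s * p s)).
Proof.
move=> jS cg; have mI := @Leb_measurable_itv R.
exact: integrableS (convex_on_integrable cg ip).
Qed.

Let left_half : `[x, m] `<=` `[x, x']%classic.
Proof. by apply: subset_itvl; rewrite bnd_simp /m; move: xx'; lra. Qed.

Let right_half : `[m, x'] `<=` `[x, x']%classic.
Proof. by apply: subset_itvr; rewrite bnd_simp /m; move: xx'; lra. Qed.

(** Reflection about the midpoint exchanges the halves, and symmetry leaves the weight unchanged. *)
Lemma Rintegral_symmetric_half (g : R -> R) :
  (Leb R).-integrable `[m, x'] (EFin \o (fun s => g s * p s)) ->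
  (Leb R).-integrable `[x, m] (EFin \o (fun s => g (x + x' - s) * p s)) /\
  \int[Leb R]_(s in `[m, x']) (g s * p s) =
  \int[Leb R]_(s in `[x, m]) (g (x + x' - s) * p s).
Proof.
move=> /(Rintegral_reflection (x + x')) [].
have -> : x + x' - x' = x by ring.
have -> : x + x' - m = m by rewrite /m; field.
have E s : s \in `[x, m]%classic -> p (x + x' - s) = p s.
  by rewrite inE => /left_half xs; rewrite [RHS]sp.
move=> ig ->; split.
  apply: eq_integrable ig => [|s /E /= -> //]; exact: Leb_measurable_itv.
by apply: eq_Rintegral => s /E ->.
Qed.

Lemma Mp_folded t : 0 <= t <= 1 ->
  (Leb R).-integrable `[x, m]
    (EFin \o (fun s => folded f alpha x x' t s * p s)) /\
  Mp f p alpha x x' t = \int[Leb R]_(s in `[x, m]) (folded f alpha x x' t s * p s).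
Proof.
move=> t01.
have lx : x <= x <= x' by rewrite lexx.
have rx : x <= x' <= x' by rewrite lexx xx'.
have c1 := convex_on_add
  (convex_on_contraction cf alpha01 t01 lx lx)
  (convex_on_contraction cf alpha01 t01 xy' rx).
have c2 := convex_on_add
  (convex_on_contraction cf alpha01 t01 xy lx)
  (convex_on_contraction cf alpha01 t01 rx rx).
have i1 := integrable_half left_half c1.
have [i2 I2] := Rintegral_symmetric_half (integrable_half right_half c2).
have E s : folded f alpha x x' t s * p s =
    (f (t * x + (1 - t) * ((1 - alpha) * x + alpha * s))
      + f (t * y' + (1 - t) * ((1 - alpha) * x' + alpha * s))) * p s +
    (f (t * y + (1 - t) * ((1 - alpha) * x + alpha * (x + x' - s)))
      + f (t * x' + (1 - t) * ((1 - alpha) * x' + alpha * (x + x' - s)))) * p s.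
  rewrite /folded -mulrDl; congr (_ * _).
  (* The terms are regrouped so that each pair has a fixed midpoint, as in [folded]. *)
  rewrite [RHS]addrACA; congr (_ + _ + (_ + _)); congr f; rewrite /y /y'; ring.
have mI := Leb_measurable_itv `[x, m].
have EE := funext E.
rewrite EE; split.
  exact: (integrableD mI i1 i2).
by rewrite RintegralD// /Mp -/m -/y -/y' I2.
Qed.

End folded_theory.

(** * Convexity, monotonicity and bounds of [Mp] *)

Unset Implicit Arguments.
Set Strict Implicit.

Theorem theorem12 (R : realType) (a b x x' alpha : R) (f p : R -> R)
    (hax : a <= x) (hxx' : x < x') (hx'b : x' <= b)
    (halpha0 : 0 < alpha) (halpha : alpha <= 1 / 2)
    (hf : convex_function (E := R^o) `[a, b] f)
    (hp0 : {in `[x, x'], forall s, 0 <= p s})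
    (hpint : (Leb R).-integrable `[x, x'] (EFin \o p))
    (hpsym : symmetric_about_midpoint x x' p) :
  let y := (1 - alpha) * x + alpha * x' in
  let y' := alpha * x + (1 - alpha) * x' in
  let M := Mp f p alpha x x' in
  let J := \int[Leb R]_(s in `[x, x'])
             ((f ((1 - alpha) * x + alpha * s)
               + f ((1 - alpha) * x' + alpha * s)) * p s) in
  let P := \int[Leb R]_(s in `[x, x']) p s in
  let A := (f x + f y + f y' + f x') / 2 in
  [/\ convex_function (E := R^o) `[0, 1] M,
      {in `[0, 1] &, {homo M : s t / s <= t}} &
      {in `[0, 1], forall t,
        [/\ J = M 0, M 0 <= M t, M t <= M 1 & M 1 = A * P] /\
        [/\ M t <= (1 - t) * J + t * A * P,
            (1 - t) * J + t * A * P <= A * P &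
            A * P <= (f x + f x') * P]}].
Proof.
move=> y y' M J P A; pose m := (x + x') / 2.
have cf : convex_on x x' f by apply: convex_onW hax hx'b _; exact/convex_functionP.
have xx' : x <= x' by exact: ltW.
have alpha01 : 0 <= alpha <= 1 by lra.
pose F t s := folded f alpha x x' t s.
pose I t := \int[Leb R]_(s in `[x, m]) (F t s * p s).
have iF t : 0 <= t <= 1 ->
    (Leb R).-integrable `[x, m] (EFin \o (fun s => F t s * p s)).
  by move=> /(Mp_folded xx' alpha01 cf hpint hpsym)[].
have MI t : 0 <= t <= 1 -> M t = I t.
  by move=> /(Mp_folded xx' alpha01 cf hpint hpsym)[].
have mm := Leb_measurable_itv `[x, m].
have p_ge0 s : x <= s <= m -> 0 <= p s.
  by move=> xsm; apply: hp0; rewrite in_itv/=; move: xsm; rewrite /m; lra.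
(* The pointwise monotonicity of [folded] is integrated against the nonnegative weight. *)
have Mnd s t : 0 <= s <= 1 -> 0 <= t <= 1 -> s <= t -> M s <= M t.
  move=> s01 t01 st; rewrite !MI//; apply: le_Rintegral => //; try exact: iF.
  move=> r; rewrite /= in_itv/= => xrm; rewrite ler_wpM2r ?p_ge0//.
  by apply: folded_nondecreasing => //; lra.
(* By linearity both sides become single integrals, and convexity is compared pointwise. *)
have cM : convex_on 0 1 M.
  move=> k s t k01 s01 t01.
  have kst01 : 0 <= k * s + (1 - k) * t <= 1 by exact: convex_comb_itv.
  rewrite !MI// /I -!RintegralZl//; try exact: iF.
  have iZ c r : 0 <= r <= 1 ->
      (Leb R).-integrable `[x, m] (EFin \o (fun s => c * (F r s * p s))).
    by move=> /iF ir; exact: (integrableZl mm c ir).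
  rewrite -RintegralD//; try exact: iZ.
  apply: le_Rintegral => //; first exact: iF.
    exact: (integrableD mm (iZ k s s01) (iZ (1 - k) t t01)).
  move=> r; rewrite /= in_itv/= => xrm.
  rewrite !mulrA -mulrDl ler_wpM2r ?p_ge0//.
  by apply: folded_convex.
have xmx' : x <= m <= x' by rewrite /m; lra.
have l01 : 0 <= (0 : R) <= 1 by lra.
have lx : x <= x <= x' by rewrite lexx.
have rx : x <= x' <= x' by rewrite lexx xx'.
have E0 c e s : 0 * c + (1 - 0) * ((1 - alpha) * e + alpha * s) =
    (1 - alpha) * e + alpha * s by ring.
(* At [t = 0] both integrands of [Mp] reduce to that of [J]; it remains to glue the halves at
   [m]. *)
have J0 : J = M 0.
  have c0 := convex_on_add
    (convex_on_contraction cf alpha01 l01 lx lx)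
    (convex_on_contraction cf alpha01 l01 lx rx).
  have ch : convex_on x x' (fun s => f ((1 - alpha) * x + alpha * s) +
      f ((1 - alpha) * x' + alpha * s)).
    by move=> k r s; have := c0 k r s; rewrite !E0.
  have i0 := convex_on_integrable ch hpint.
  rewrite /J (Rintegral_itv_split xmx' i0) /M /Mp -/m.
  by congr (_ + _); apply: eq_Rintegral => s _ /=; rewrite !E0.
have iS (j : interval R) : [set` j] `<=` `[x, x']%classic ->
    (Leb R).-integrable [set` j] (EFin \o p).
  move=> jS; have mI := @Leb_measurable_itv R.
  exact: integrableS hpint.
(* Folding with the constant function 1 shows that both halves carry the same mass. *)
have PE : P = 2 * \int[Leb R]_(s in `[x, m]) p s.
  have := Rintegral_symmetric_half xx' hpsym (g := cst 1).
  have cst1 : EFin \o (fun s => cst 1 s * p s) = EFin \o p.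
    by apply/funext => s /=; rewrite mul1r.
  rewrite cst1 => -[|_].
    by apply: iS; apply: subset_itvr; rewrite bnd_simp; lra.
  under eq_Rintegral do rewrite mul1r.
  under [in X in _ = X]eq_Rintegral do rewrite mul1r.
  rewrite -/m /P (Rintegral_itv_split xmx' hpint) => ->.
  by ring.
(* At [t = 1] the displacement vanishes and the folded integrand is the constant [2 * A]; this 2
   matches the one in [PE]. *)
have M1 : M 1 = A * P.
  rewrite MI ?ler01 ?lexx// /I PE.
  have -> : A * (2 * \int[Leb R]_(s in `[x, m]) p s) =
      (f x + f y + f y' + f x') * \int[Leb R]_(s in `[x, m]) p s.
    by rewrite /A; field.
  rewrite -RintegralZl//; last first.
    by apply: iS; apply: subset_itvl; rewrite bnd_simp; lra.
  apply: eq_Rintegral => s _; congr (_ * _).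
  by rewrite /F /folded subrr mul0r !addr0 !subr0 !addrA.
have P0 : 0 <= P.
  by apply: Rintegral_ge0 => s /=; exact: hp0.
(* [y] and [y'] are mirror images, so [f y + f y'] is at most [f x + f x']. *)
have AP : A * P <= (f x + f x') * P.
  apply: ler_wpM2r => //.
  have xyx' : x <= y <= x'.
    have a01 : 0 <= 1 - alpha <= 1 by lra.
    by have := convex_comb_itv a01 lx rx; rewrite subKr.
  have := convex_on_symmetric_le cf xyx'.
  have -> : x + x' - y = y' by rewrite /y /y'; ring.
  by rewrite /A; lra.
split; first exact/convex_functionP.
  by move=> s t; rewrite !in_itv/=; exact: Mnd.
move=> t; rewrite in_itv/= => t01.
have M0t : M 0 <= M t by apply: Mnd => //; lra.
have Mt1 : M t <= M 1 by apply: Mnd => //; lra.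
(* Convexity between 0 and 1 with weight [1 - t] on 0 bounds [M t] by the chord from [M 0 = J] to
   [M 1 = A * P]; the chord is at most [M 1] because [M 0 <= M 1]. *)
have := cM (1 - t) 0 1; rewrite mulr0 mulr1 add0r subKr J0 -mulrA -M1.
move=> cMt; split; split => //; first by apply: cMt; lra.
  by nra.
by rewrite M1.
Qed.
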